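(* Let $N$ be a unitarily invariant norm on $M_n(\mathbb{C})$ and let $A,X\in M_n(\mathbb{C})$ with $A$ positive definite. Then for every $t\in[0,1]$, $$w_N(A^tXA^t)\le \big(w_N(AXA)\big)^{t}\,\big(w_N(X)\big)^{1-t},$$ and $$2\,w_N\big(A^{1/2}XA^{1/2}\big)\le w_N\big(A^tXA^{1-t}+A^{1-t}XA^{t}\big)\le w_N(AX+XA).$$
   Context: For a norm $N$ on $M_n(\mathbb{C})$ (the $n\times n$ complex matrices), the generalized numerical radius of $Y\in M_n(\mathbb{C})$ is $w_N(Y)=\sup_{\theta\in\mathbb{R}}N(\mathrm{Re}(e^{i\theta}Y))$, where $\mathrm{Re}(Z)=\frac12(Z+Z^* )$. The norm $N$ is unitarily invariant if $N(UYV)=N(Y)$ for all $Y\in M_n(\mathbb{C})$ and all unitary $U,V\in M_n(\mathbb{C})$. For a positive definite (Hermitian) matrix $A$ and $t\in\mathbb{R}$, $A^t$ is defined by the functional calculus. *)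

(* Defs.v *)
From HB Require Import structures.
From mathcomp Require Import all_boot all_order all_algebra.
From mathcomp Require Import sesquilinear spectral.
From mathcomp Require Import complex.
From mathcomp Require Import all_classical all_reals all_analysis.

Set Implicit Arguments.
Unset Strict Implicit.
Unset Printing Implicit Defensive.

Import Order.TTheory GRing.Theory Num.Theory.

Local Open Scope classical_set_scope.
Local Open Scope ring_scope.
Local Open Scope complex_scope.
Local Open Scope sesquilinear_scope.

Section Definitions.
Context {R : realType} {n : nat}.
Implicit Types (N : 'M[R[i]]_n -> R) (A U V X Y Z : 'M[R[i]]_n).

(* The homogeneity axiom is stated in R[i], where the modulus `|c| lives. *)
Record matrix_norm N : Prop := MatrixNorm {
  matrix_norm_ge0 : forall Y, 0 <= N Y;
  matrix_norm_eq0 : forall Y, N Y = 0 -> Y = 0;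
  matrix_normZ : forall (c : R[i]) Y, (N (c *: Y))%:C = `|c| * (N Y)%:C;
  matrix_normD : forall Y Z, N (Y + Z) <= N Y + N Z }.

Definition unitarily_invariant N : Prop :=
  forall U V Y, U \is unitarymx -> V \is unitarymx -> N (U *m Y *m V) = N Y.

Definition mxRe Z : 'M[R[i]]_n := 2^-1 *: (Z + Z ^t*).

Definition expi (theta : R) : R[i] := cos theta +i* sin theta.

Definition num_radius N Y : R :=
  sup [set N (mxRe (expi theta *: Y)) | theta in [set: R]].

(* In the order of R[i], 0 < z means that z is real and positive. *)
Definition posdefmx A : Prop :=
  A \is hermsymmx /\
  forall v : 'cV[R[i]]_n, v != 0 -> 0 < (v ^t* *m A *m v) 0 0.

(* Functional calculus: A = P^-1 *m diag_mx d *m P with P := spectralmx A     *)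
(* unitary and d := spectral_diag A real, when A is Hermitian; meaningless    *)
(* otherwise.                                                                 *)
Definition mxfun (f : R -> R) A : 'M[R[i]]_n :=
  invmx (spectralmx A)
  *m diag_mx (map_mx (fun z : R[i] => (f (complex.Re z))%:C) (spectral_diag A))
  *m spectralmx A.

Definition mxpow A (t : R) : 'M[R[i]]_n := mxfun (fun x => x `^ t) A.

End Definitions.

(* The supremum defining num_radius is that of a nonempty bounded set.        *)
Lemma num_radius_has_sup (R : realType) (n : nat) (N : 'M[R[i]]_n -> R)
    (Y : 'M[R[i]]_n) : matrix_norm N ->
  has_sup [set N (mxRe (expi theta *: Y)) | theta in [set: R]].
Proof.
move=> nN; split; first by exists (N (mxRe (expi 0 *: Y))), 0.
have norm_expi (a : R) : `|expi a| = 1.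
  by rewrite normc_def /= cos2Dsin2 sqrtr1.
have NZ1 (c : R[i]) (Z : 'M[R[i]]_n) : `|c| = 1 -> N (c *: Z) = N Z.
  by move=> c1; have := matrix_normZ nN c Z; rewrite c1 mul1r => -[].
exists (N (2^-1 *: Y) + N (2^-1 *: Y ^t*)) => _ [a _ <-].
rewrite /mxRe scalerDr (le_trans (matrix_normD nN _ _))//.
rewrite scalerA [2^-1 * _]mulrC -scalerA (NZ1 (expi a))//.
have -> : (expi a *: Y) ^t* = Num.conj (expi a) *: Y ^t*.
  by apply/matrixP => i j; rewrite !mxE rmorphM.
by rewrite scalerA [2^-1 * _]mulrC -scalerA (NZ1 (Num.conj _)) ?norm_conjC.
Qed.

(* Main.v *)
(* Write [y i j = p i - q j]. Entrywise multiplication by [cos (h * y i j)]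
   averages two unitary equivalences, so it does not increase a unitarily
   invariant norm. As [expR u + expR (- u) = 4 - 2 * cos u + o(u ^+ 2)], the
   norms of the matrices with entries [expR (s * y i j) * K i j], and of those with
   entries [(expR (s * y i j) + expR (- (s * y i j))) * K i j], have second
   differences in [s] bounded below by [- o(h ^+ 2)], hence satisfy the maximum
   principle on intervals. In an eigenbasis of [A] the first family gives the
   log-convexity of [N (A^t H A^t)] and the second the Heinz inequalities, for
   every matrix [H]. The numerical radius follows by taking [H] to be the real
   part of [e^(i theta) X], since the powers of [A] are Hermitian. *)
Require Import Defs.
From mathcomp Require Import all_boot all_order all_algebra.
From mathcomp Require Import sesquilinear spectral.
From mathcomp Require Import complex ring lra.
From mathcomp Require Import all_classical all_reals all_analysis.

Set Implicit Arguments.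
Unset Strict Implicit.
Unset Printing Implicit Defensive.

Import Order.TTheory GRing.Theory Num.Theory.
Import numFieldNormedType.Exports.

Local Open Scope classical_set_scope.
Local Open Scope ring_scope.
Local Open Scope complex_scope.
Local Open Scope sesquilinear_scope.

(** * One-variable real analysis *)

Section RealFunctions.
Variable R : realType.
Implicit Types (phi : R -> R) (a b s t h y : R).

Lemma max_principle phi a b t : continuous phi ->
  (forall s e, 0 < e -> \forall h \near 0^'+,
     2 * phi s <= phi (s + h) + phi (s - h) + e * h ^+ 2) ->
  a <= t <= b -> phi t <= Num.max (phi a) (phi b).
Proof.
move=> cphi dphi /andP[at_ tb].
suff H e : 0 < e -> phi t <= Num.max (phi a) (phi b) + e * (a ^+ 2 + b ^+ 2).
  apply/ler_addgt0Pr => e e0.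
  set k := a ^+ 2 + b ^+ 2.
  have k1 : 0 < k + 1 by rewrite ltr_wpDl// addr_ge0// sqr_ge0.
  apply: le_trans (H _ (divr_gt0 e0 k1)) _.
  by rewrite lerD2l -/k mulrAC ler_pdivrMr// ler_pM2l// lerDl.
(* The perturbation [e * s ^+ 2] rules out an interior maximum. *)
move=> e0; pose psi s := phi s + e * s ^+ 2.
have cpsi : continuous psi.
  move=> s; apply: cvgD; first exact: cphi.
  by apply: cvgM; [exact: cvg_cst | exact: (@exprn_continuous R 2)].
have [c cab cmax] := EVT_max (le_trans at_ tb) (continuous_subspaceT cpsi).
have /cmax : t \in `[a, b] by rewrite in_itv/= at_ tb.
have t2 := mulr_ge0 (ltW e0) (sqr_ge0 t).
have a2 := mulr_ge0 (ltW e0) (sqr_ge0 a).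
have b2 := mulr_ge0 (ltW e0) (sqr_ge0 b).
have mxa : phi a <= Num.max (phi a) (phi b) by rewrite le_max lexx.
have mxb : phi b <= Num.max (phi a) (phi b) by rewrite le_max lexx orbT.
rewrite /psi => tc.
have [ac|ca|ca] := ltgtP a c; last 2 first.
- by move: cab; rewrite in_itv/= leNgt ca.
- by move: tc; rewrite -ca; lra.
have [cb|bc|cb] := ltgtP c b; last 2 first.
- by move: cab; rewrite in_itv/= [c <= b]leNgt bc andbF.
- by move: tc; rewrite cb; lra.
(* At an interior maximum [c] of [psi] the second difference is at most [0], yet it is at least
   [2 * e * h ^+ 2 - e * h ^+ 2]. *)
near (0 : R)^'+ => h.
have h0 : 0 < h by near: h; exact: nbhs_right_gt.
have hb : h < b - c by near: h; apply: nbhs_right_lt; rewrite subr_gt0.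
have ha : h < c - a by near: h; apply: nbhs_right_lt; rewrite subr_gt0.
have dh : 2 * phi c <= phi (c + h) + phi (c - h) + e * h ^+ 2.
  by near: h; exact: dphi.
have /cmax : c + h \in `[a, b] by rewrite in_itv/=; apply/andP; split; lra.
have /cmax : c - h \in `[a, b] by rewrite in_itv/=; apply/andP; split; lra.
rewrite /psi.
have := mulr_gt0 e0 (exprn_gt0 2 h0).
by move: dh; lra.
Unshelve. all: by end_near. Qed.

Lemma expRD_cos_defect y e : 0 < e -> \forall h \near 0^'+,
  `|expR (h * y) + expR (- (h * y)) - 4 + 2 * cos (h * y)| <= e * h ^+ 2.
Proof.
(* The left-hand side is the product of [expR u - expR (- u) - 2 * sin u] and
   [expR u - expR (- u) + 2 * sin u] at [u = h * y / 2]; both are [O(h)], and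
   the first has derivative [0] at [0]. *)
move=> e0; pose v := y / 2.
pose G (c h : R) := expR (h * v) - expR (- (h * v)) + c * sin (h * v).
have dG c : h^-1 * G c h @[h --> 0^'] --> 2 * v + c * v.
  have G0 : is_derive (0 : R) (1 : R) (G c) (2 * v + c * v).
    rewrite /G; apply: is_derive_eq.
    rewrite !(mul0r, mulr0, oppr0, expR0, cos0, addr0, add0r, scaler0).
    rewrite /GRing.scale/=; ring.
  have := @ex_derive _ _ _ _ _ _ _ G0.
  have [H1 H2] := G0.
  move=> /cvg_ex[l lP]; have := lP; rewrite -H2 /derive.
  move/cvg_lim: (lP) => -> //.
  apply: cvg_trans; apply: near_eq_cvg; near=> h => /=.
  rewrite addr0 /G !(mul0r, oppr0, expR0, sin0, mulr0, subrr, addr0, subr0).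
  by rewrite [h *: 1]mulr1.
have : (h^-1 * G (-2) h) * (h^-1 * G 2 h) @[h --> 0^'] -->
    (2 * v + - 2 * v) * (2 * v + 2 * v) by exact: (cvgM (dG (-2)) (dG 2)).
rewrite (_ : (2 * v + - 2 * v) * _ = 0); last by ring.
move=> /cvg_dnbhs_at_right /cvgr0_norm_le /(_ _ e0) H; near=> h.
have h0 : 0 < h by near: h; exact: nbhs_right_gt.
have : `|h^-1 * G (- 2) h * (h^-1 * G 2 h)| <= e by near: h.
have -> : h^-1 * G (- 2) h * (h^-1 * G 2 h) =
  (expR (h * y) + expR (- (h * y)) - 4 + 2 * cos (h * y)) / h ^+ 2.
  have -> : h * y = h * v + h * v by rewrite /v; lra.
  rewrite [- (h * v + h * v)]opprD !expRD cosD /G.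
  have := cos2Dsin2 (h * v).
  have := expRxMexpNx_1 (h * v).
  move: (expR _) (expR _) (cos _) (sin _) => a b c s ab cs.
  have h0' : h != 0 by rewrite gt_eqF.
  (* With [4] expanded through both relations, the factorisation becomes a polynomial identity. *)
  have -> : 4 = 2 * b * a + 2 * (c ^+ 2 + s ^+ 2) by rewrite -mulrA ab cs; ring.
  by field.
rewrite normrM normfV [`|h ^+ 2|]ger0_norm ?sqr_ge0//.
by rewrite ler_pdivrMr// exprn_gt0.
Unshelve. all: by end_near. Qed.

(** Tilting by [expR (- (s * c))] equalises the values [a] at [s = 0] and [b] at [s = 1]; undoing
    the tilt at [t] turns their maximum into a weighted geometric mean. *)
Lemma powR_interpolation (a b t : R) : 0 < a -> 0 < b ->
  exists2 c, expR (- c) * b = a & b `^ t * a `^ (1 - t) = expR (t * c) * a.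
Proof.
move=> a0 b0; exists (ln (b / a)).
  by rewrite expRN lnK ?posrE ?divr_gt0// invf_div mulfVK ?gt_eqF.
rewrite /powR !gt_eqF// -expRD ln_div ?posrE//.
rewrite -[X in _ = _ * X]lnK ?posrE// -expRD; congr expR; ring.
Qed.

End RealFunctions.

(** * Entrywise multiplication by real matrices *)

Section RealHadamard.
Variables (R : realType) (n : nat).
Implicit Types (m : 'I_n -> 'I_n -> R) (W : 'M[R[i]]_n).

Definition hadamard m W : 'M[R[i]]_n := \matrix_(i, j) ((m i j)%:C * W i j).

Lemma hadamardM m1 m2 W :
  hadamard m1 (hadamard m2 W) = hadamard (fun i j => m1 i j * m2 i j) W.
Proof. by apply/matrixP => i j; rewrite !mxE rmorphM mulrA. Qed.

Lemma hadamardD m1 m2 W :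
  hadamard (fun i j => m1 i j + m2 i j) W = hadamard m1 W + hadamard m2 W.
Proof. by apply/matrixP => i j; rewrite !mxE rmorphD mulrDl. Qed.

Lemma hadamardZ (c : R) m W :
  hadamard (fun i j => c * m i j) W = c%:C *: hadamard m W.
Proof. by apply/matrixP => i j; rewrite !mxE rmorphM mulrA. Qed.

Lemma eq_hadamard m1 m2 W : (forall i j, m1 i j = m2 i j) ->
  hadamard m1 W = hadamard m2 W.
Proof. by move=> e; apply/matrixP => i j; rewrite !mxE e. Qed.

Lemma diag_mx_mul_diag (a b : 'I_n -> R) W :
  diag_mx (\row_i (a i)%:C) *m W *m diag_mx (\row_i (b i)%:C)
  = hadamard (fun i j => a i * b j) W.
Proof.
apply/matrixP => i j; rewrite mul_mx_diag mul_diag_mx !mxE rmorphM.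
by rewrite mulrAC.
Qed.

End RealHadamard.

(** * Unitarily invariant norms under entrywise multipliers *)

Section NormHadamard.
Variables (R : realType) (n : nat) (N : 'M[R[i]]_n -> R).
Hypotheses (hN : matrix_norm N) (hU : unitarily_invariant N).
Implicit Types (m : 'I_n -> 'I_n -> R) (W X Y Z : 'M[R[i]]_n).

Lemma normc_real (c : R) : `|c%:C| = `|c|%:C.
Proof. by rewrite normc_def /= expr0n addr0 sqrtr_sqr. Qed.

Lemma matrix_normZr (c : R) Y : N (c%:C *: Y) = `|c| * N Y.
Proof.
by have := matrix_normZ hN c%:C Y; rewrite normc_real -rmorphM => /complexI.
Qed.

Lemma matrix_norm0 : N 0 = 0.
Proof. by rewrite -(scale0r (0 : 'M[R[i]]_n)) matrix_normZr normr0 mul0r. Qed.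

Lemma matrix_normN Y : N (- Y) = N Y.
Proof.
have := matrix_normZr (-1) Y.
by rewrite rmorphN1 scaleN1r normrN1 mul1r.
Qed.

Lemma matrix_norm_gt0 Y : Y != 0 -> 0 < N Y.
Proof.
move=> Y0; rewrite lt_neqAle (matrix_norm_ge0 hN) andbT eq_sym.
by apply: contra Y0 => /eqP/(matrix_norm_eq0 hN) ->.
Qed.

Lemma matrix_norm_sum (I : Type) (r : seq I) (F : I -> 'M[R[i]]_n) :
  N (\sum_(i <- r) F i) <= \sum_(i <- r) N (F i).
Proof.
elim/big_ind2 : _ => [|x y z w|//]; first by rewrite matrix_norm0.
by move=> xy zw; apply: le_trans (matrix_normD hN _ _) (lerD _ _).
Qed.

Lemma matrix_norm_dist Y Z : `|N Y - N Z| <= N (Y - Z).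
Proof.
have h1 := matrix_normD hN (Y - Z) Z; rewrite subrK in h1.
have h2 := matrix_normD hN (Z - Y) Y; rewrite subrK in h2.
by rewrite -opprB matrix_normN in h2; rewrite ler_norml; lra.
Qed.

Lemma norm_hadamard_le_sum m W :
  N (hadamard m W) <=
  \sum_i \sum_j `|m i j| * N (W i j *: delta_mx i j).
Proof.
rewrite [hadamard m W]matrix_sum_delta.
apply: le_trans (matrix_norm_sum _ _) _; apply: ler_sum => i _.
apply: le_trans (matrix_norm_sum _ _) _; apply: ler_sum => j _.
by rewrite mxE -scalerA matrix_normZr.
Qed.

Lemma diag_expi_unitary (p : 'I_n -> R) :
  diag_mx (\row_i expi (p i)) \is @unitarymx _ n n.
Proof.
apply/unitarymxP/matrixP => i j.
rewrite tr_diag_mx map_diag_mx mul_mx_diag !mxE.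
have [->|] := eqVneq i j; last by rewrite mulr0n mul0r.
by rewrite !mulr1n -normCK normc_def /= cos2Dsin2 sqrtr1 expr1n.
Qed.

Lemma norm_hadamard_cos (p q : 'I_n -> R) W :
  N (hadamard (fun i j => cos (p i - q j)) W) <= N W.
Proof.
pose D (r : 'I_n -> R) := diag_mx (\row_i expi (r i)).
(* Euler's formula for the cosine; each exponential splits into a row phase and a column phase. *)
have -> : hadamard (fun i j => cos (p i - q j)) W =
  (2^-1)%:C *: (D p *m W *m D (fun j => - q j)
                + D (fun i => - p i) *m W *m D q).
  apply/matrixP => i j; rewrite !mul_mx_diag !mul_diag_mx !mxE.
  rewrite cosD cosN sinN /expi !cosN !sinN.
  move: (W i j) => [a b]; apply/eqP.
  rewrite eq_complex; apply/andP; split; apply/eqP => /=; by field.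
rewrite matrix_normZr ger0_norm ?invr_ge0//.
have /le_trans -> // : 2^-1 * N (D p *m W *m D (fun j => - q j)
   + D (fun i => - p i) *m W *m D q) <= 2^-1 * (N W + N W).
  rewrite ler_pM2l// (le_trans (matrix_normD hN _ _))//.
  by rewrite !hU ?diag_expi_unitary.
lra.
Qed.

(** Finitely many entries can be controlled simultaneously. Taking [g] constant gives continuity,
    and [g h = h ^+ 2] handles the second-order defect. *)
Lemma norm_hadamard_near (T : Type) (F : set_system T) (FF : Filter F)
    (m : T -> 'I_n -> 'I_n -> R) (g : T -> R) W :
  (forall x, 0 <= g x) ->
  (forall i j e, 0 < e -> \forall x \near F, `|m x i j| <= e * g x) ->
  forall e, 0 < e -> \forall x \near F, N (hadamard (m x) W) <= e * g x.
Proof.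
move=> g0 mg e e0; pose K := \sum_i \sum_j N (W i j *: delta_mx i j).
have K0 : 0 < K + 1.
  rewrite ltr_wpDl// sumr_ge0// => i _; rewrite sumr_ge0// => j _.
  exact: matrix_norm_ge0.
(* Chosen so that [d * K <= e]; the [+ 1] covers [K = 0]. *)
pose d := e / (K + 1).
have d0 : 0 < d by rewrite divr_gt0.
pose P (ij : 'I_n * 'I_n) x := `|m x ij.1 ij.2| <= d * g x.
have : \forall x \near F, forall ij, P ij x.
  by apply: filter_forall => -[i j]; exact: mg.
apply: filterS => x Px; apply: le_trans (norm_hadamard_le_sum _ _) _.
apply: (@le_trans _ _ (d * g x * K)).
  rewrite mulr_sumr ler_sum// => i _; rewrite mulr_sumr ler_sum// => j _.
  by apply: ler_wpM2r; [exact: matrix_norm_ge0 | exact: (Px (i, j))].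
rewrite mulrAC ler_wpM2r ?g0// /d mulrAC ler_pdivrMr// ler_pM2l//.
by rewrite lerDl.
Qed.

Lemma norm_hadamard_continuous (m : R -> 'I_n -> 'I_n -> R) W :
  (forall i j, continuous (fun s => m s i j)) ->
  continuous (fun s => N (hadamard (m s) W)).
Proof.
move=> cm s; apply/cvgrPdist_le => e e0.
have : \forall x \near s,
    N (hadamard (fun i j => m s i j - m x i j) W) <= e * 1.
  apply: (@norm_hadamard_near _ (nbhs s) _
    (fun x i j => m s i j - m x i j) (fun=> 1)) => // i j d d0.
  by rewrite mulr1; move: (cm i j s) => /cvgrPdist_le; apply.
apply: filterS => x; rewrite mulr1; apply: le_trans.
have -> : hadamard (fun i j => m s i j - m x i j) W =
    hadamard (m s) W - hadamard (m x) W.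
  by apply/matrixP => i j; rewrite !mxE rmorphB mulrBl.
exact: matrix_norm_dist.
Qed.

(* The hypothesis on [m] is the functional equation shared by [expR (s * y)]
   and [expR (s * y) + expR (- (s * y))] with [y = p i - q j]. *)
Lemma norm_hadamard_max (p q : 'I_n -> R) (m : R -> 'I_n -> 'I_n -> R) W
    (a b t : R) :
  (forall i j, continuous (fun s => m s i j)) ->
  (forall s h i j, m (s + h) i j + m (s - h) i j =
     (expR (h * (p i - q j)) + expR (- (h * (p i - q j)))) * m s i j) ->
  a <= t <= b ->
  N (hadamard (m t) W) <=
  Num.max (N (hadamard (m a) W)) (N (hadamard (m b) W)).
Proof.
move=> cm em; apply: (@max_principle _ (fun s => N (hadamard (m s) W))).
  exact: norm_hadamard_continuous.
move=> s e e0; set V := hadamard (m s) W.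
pose r h i j := expR (h * (p i - q j)) + expR (- (h * (p i - q j)))
  - 4 + 2 * cos (h * (p i - q j)).
have : \forall h \near 0^'+, N (hadamard (r h) V) <= e * h ^+ 2.
  apply: (@norm_hadamard_near _ _ _ r (fun h => h ^+ 2)) => //.
    by move=> h; exact: sqr_ge0.
  by move=> i j d d0; exact: expRD_cos_defect.
apply: filterS => h Nr.
pose C := hadamard (fun i j => cos (h * p i - h * q j)) V.
(* The functional equation, with the exponentials replaced by [4 - 2 * cos + r]. Taking norms,
   [2%:C *: C] costs at most [2 * N V], which leaves [2 * N V] on the left. *)
have E : 4%:C *: V = hadamard (m (s + h)) W + hadamard (m (s - h)) W
    + 2%:C *: C - hadamard (r h) V.
  rewrite -hadamardD (eq_hadamard _ (em s h)) -hadamardM -/V.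
  apply/matrixP => i j; rewrite !mxE -mulrBr.
  rewrite /r !(rmorphD, rmorphN, rmorphM) /=; ring.
have NC : N C <= N V := norm_hadamard_cos _ _ _.
have := congr1 N E; rewrite matrix_normZr ger0_norm//.
have := matrix_normD hN (hadamard (m (s + h)) W + hadamard (m (s - h)) W
    + 2%:C *: C) (- hadamard (r h) V).
have := matrix_normD hN (hadamard (m (s + h)) W + hadamard (m (s - h)) W)
    (2%:C *: C).
have := matrix_normD hN (hadamard (m (s + h)) W) (hadamard (m (s - h)) W).
rewrite matrix_normN matrix_normZr ger0_norm//; lra.
Qed.

End NormHadamard.

(** * Real parts and Hermitian factors *)

Section MatrixRealPart.
Variables (R : realType) (n : nat) (B C : 'M[R[i]]_n).
Hypotheses (hB : B^t* = B) (hC : C^t* = C).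

Lemma trmxC_mul3 (D Y E : 'M[R[i]]_n) :
  (D *m Y *m E)^t* = E^t* *m Y^t* *m D^t*.
Proof. by rewrite !trmx_mul !map_mxM mulmxA. Qed.

Lemma mxRe_congruence (c : R[i]) X :
  mxRe (c *: (B *m X *m B)) = B *m mxRe (c *: X) *m B.
Proof.
rewrite scalemxAl scalemxAr; move: (c *: X) => Y.
by rewrite /mxRe trmxC_mul3 hB -scalemxAr -scalemxAl mulmxDr mulmxDl.
Qed.

(** Taking adjoints exchanges the outer factors [B] and [C], so the symmetrised sum is what commutes
    with the real part. *)
Lemma mxRe_sandwich (c : R[i]) X :
  mxRe (c *: (B *m X *m C + C *m X *m B)) =
  B *m mxRe (c *: X) *m C + C *m mxRe (c *: X) *m B.
Proof.
have sE (D E : 'M[R[i]]_n) : c *: (D *m X *m E) = D *m (c *: X) *m E.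
  by rewrite scalemxAl scalemxAr.
rewrite scalerDr !sE; move: (c *: X) => Y.
rewrite /mxRe [(_ + _)^T]linearD map_mxD !trmxC_mul3 hB hC.
rewrite -!scalemxAr -!scalemxAl -scalerDr !mulmxDr !mulmxDl.
by rewrite [X in _ *: (_ + X) = _]addrC; apply: (congr1 _ (addrACA _ _ _ _)).
Qed.

End MatrixRealPart.

(** * Spectral form of the powers of a positive definite matrix *)

Section PositiveDefinite.
Variables (R : realType) (n : nat) (A : 'M[R[i]]_n).
Hypothesis hA : posdefmx A.

(** On the logarithmic scale, powers of [A] act as exponential multipliers. *)
Definition log_eigen (i : 'I_n) : R := ln (complex.Re (spectral_diag A 0 i)).

Lemma posdefmx_spectral : A =
  (spectralmx A)^t* *m diag_mx (spectral_diag A) *m spectralmx A.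
Proof.
have /hermitian_normalmx /orthomx_spectralP {1}-> := hA.1.
by rewrite invmx_unitary// spectral_unitarymx.
Qed.

(** The quadratic form at the [i]-th eigenvector, column [i] of [P^t*], is the [i]-th eigenvalue. *)
Lemma posdefmx_spectral_diag_gt0 i : 0 < spectral_diag A 0 i.
Proof.
pose P := spectralmx A; pose v : 'cV_n := P^t* *m delta_mx i 0.
have PU : P *m P^t* = 1%:M by apply/unitarymxP/spectral_unitarymx.
have Pv : P *m v = delta_mx i 0 by rewrite mulmxA PU mul1mx.
have v0 : v != 0.
  apply/eqP => v0; move: Pv; rewrite v0 mulmx0 => /matrixP/(_ i 0).
  by rewrite !mxE !eqxx => /eqP; rewrite eq_sym oner_eq0.
clearbody v; have := hA.2 v v0; rewrite {1}posdefmx_spectral -/P.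
have -> : v^t* *m (P^t* *m diag_mx (spectral_diag A) *m P) *m v =
    (P *m v)^t* *m diag_mx (spectral_diag A) *m (P *m v).
  by rewrite trmx_mul map_mxM !mulmxA.
by rewrite Pv -colE mul_mx_diag !mxE !eqxx /= rmorph1 mul1r.
Qed.

Lemma mxpowE t : mxpow A t = (spectralmx A)^t* *m
  diag_mx (\row_i (expR (t * log_eigen i))%:C) *m spectralmx A.
Proof.
rewrite /mxpow /mxfun invmx_unitary ?spectral_unitarymx//.
congr (_ *m diag_mx _ *m _); apply/rowP => i; rewrite !mxE.
have := posdefmx_spectral_diag_gt0 i; rewrite ltcE => /andP[_ d0].
(* Positivity excludes the separate branch of [powR] at base [0]. *)
by rewrite /powR gt_eqF.
Qed.

Lemma mxpow0 : mxpow A 0 = 1%:M.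
Proof.
rewrite mxpowE; set D := diag_mx _; have -> : D = 1%:M.
  by apply/matrixP => i j; rewrite !mxE mul0r expR0.
by rewrite mulmx1 -invmx_unitary ?spectral_unitarymx// mulVmx ?spectral_unit.
Qed.

Lemma mxpow1 : mxpow A 1 = A.
Proof.
rewrite mxpowE [RHS]posdefmx_spectral.
congr (_ *m diag_mx _ *m _); apply/rowP => i; rewrite !mxE mul1r.
(* Positivity in [R[i]] includes a zero imaginary part, so the real part recovers the eigenvalue. *)
have := posdefmx_spectral_diag_gt0 i; rewrite ltcE => /andP[/eqP di d0].
by rewrite lnK//; case: (spectral_diag A 0 i) di {d0} => a b /= ->.
Qed.

Lemma mxpow_herm t : (mxpow A t)^t* = mxpow A t.
Proof.
rewrite mxpowE !trmx_mul !map_mxM trmxCK mulmxA tr_diag_mx map_diag_mx.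
congr (_ *m diag_mx _ *m _); apply/rowP => i; rewrite !mxE.
exact: conjc_real.
Qed.

Lemma mxpow_mul_mxpow (a b : R) (H : 'M[R[i]]_n) :
  mxpow A a *m H *m mxpow A b = (spectralmx A)^t* *m
    hadamard (fun i j => expR (a * log_eigen i) * expR (b * log_eigen j))
      (spectralmx A *m H *m (spectralmx A)^t*) *m spectralmx A.
Proof. by rewrite !mxpowE -diag_mx_mul_diag !mulmxA. Qed.

End PositiveDefinite.

(** * Log-convexity, Heinz inequalities and the passage to the numerical radius *)

Section UnitarilyInvariantNorm.
Variables (R : realType) (n : nat) (N : 'M[R[i]]_n -> R) (A : 'M[R[i]]_n).
Hypotheses (hN : matrix_norm N) (hU : unitarily_invariant N).
Hypothesis hA : posdefmx A.
Implicit Types H X : 'M[R[i]]_n.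

Local Notation x := (log_eigen A).
Local Notation P := (spectralmx A).

Lemma norm_spectral W : N (P^t* *m W *m P) = N W.
Proof. by rewrite hU ?trmxC_unitary ?spectral_unitarymx. Qed.

Lemma norm_spectralD V W :
  N (P^t* *m V *m P + P^t* *m W *m P) = N (V + W).
Proof. by rewrite -[RHS]norm_spectral mulmxDr mulmxDl. Qed.

(* With [c] the logarithm of [N (A H A) / N H], the multipliers
   [expR (s * (x i + x j - c))] give equal norms at [s = 0] and [s = 1]. *)
Lemma norm_mxpow_log_convex H t : 0 <= t <= 1 ->
  N (mxpow A t *m H *m mxpow A t) <= N (A *m H *m A) `^ t * N H `^ (1 - t).
Proof.
move=> t01; have [->|H0] := eqVneq H 0.
  by rewrite mulmx0 mul0mx (matrix_norm0 hN) mulr_ge0 ?powR_ge0.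
pose K := P *m H *m P^t*.
pose g s := N (mxpow A s *m H *m mxpow A s).
have g0E : N H = g 0 by rewrite /g mxpow0// mul1mx mulmx1.
have g1E : N (A *m H *m A) = g 1 by rewrite /g mxpow1.
have K0 : K != 0.
  apply: contra H0 => /eqP K0.
  have -> : H = P^t* *m K *m P.
    rewrite /K -(invmx_unitary (spectral_unitarymx A)) -!mulmxA.
    by rewrite mulVmx ?spectral_unit// mulmx1 mulKmx ?spectral_unit.
  by rewrite K0 mulmx0 mul0mx.
(* Needed for the logarithm [c]: exponential multipliers never vanish, so they keep [K] nonzero. *)
have gt0 s : 0 < g s.
  rewrite /g mxpow_mul_mxpow// norm_spectral; apply: matrix_norm_gt0 => //.
  apply: contra K0 => /eqP/matrixP E; apply/eqP/matrixP => i j.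
  move/eqP: (E i j); rewrite [hadamard _ _ _ _]mxE [RHS]mxE [X in _ == X]mxE.
  rewrite mulf_eq0 => /orP[|/eqP//].
  rewrite -(rmorph0 (real_complex R)) (inj_eq (@complexI R)).
  by rewrite -expRD gt_eqF ?expR_gt0.
have [c Ec Et] := powR_interpolation t (gt0 0) (gt0 1).
(* [x i + x j - c] is written in the form [p i - q j] with [q j = c - x j]. *)
have gE s : N (hadamard (fun i j => expR (s * (x i - (c - x j)))) K) =
    expR (- (s * c)) * g s.
  rewrite /g mxpow_mul_mxpow// norm_spectral -[expR (- _)]ger0_norm ?expR_ge0//.
  rewrite -(matrix_normZr hN) -hadamardZ; congr N; apply: eq_hadamard => i j.
  by rewrite -!expRD; congr expR; ring.
have := @norm_hadamard_max _ _ _ hN hU x (fun j => c - x j)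
  (fun s i j => expR (s * (x i - (c - x j)))) K 0 1 t.
rewrite g0E g1E -/(g t) Et !gE mul0r oppr0 expR0 mul1r (mul1r c) Ec maxxx.
move=> H1; rewrite -ler_pdivrMl ?expR_gt0// -expRN; apply: H1 => //.
  move=> i j s; apply: continuous_comp; last exact: continuous_expR.
  by apply: cvgM; [exact: cvg_id | exact: cvg_cst].
by move=> s h i j; rewrite [RHS]mulrDl -!expRD; congr (expR _ + expR _); ring.
Qed.

(** Centring the exponents at [2^-1] makes this an even function of [a]. *)
Definition heinz a H := N (mxpow A (2^-1 + a) *m H *m mxpow A (2^-1 - a)
  + mxpow A (2^-1 - a) *m H *m mxpow A (2^-1 + a)).

Lemma heinzN H a : heinz (- a) H = heinz a H.
Proof. by rewrite /heinz (opprK a); apply: (congr1 N (addrC _ _)). Qed.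

(** The maximum principle on the interval from [- b] to [b], for [b >= 0], whose endpoint values
    agree by evenness. *)
Lemma heinz_le H (a b : R) : `|a| <= `|b| -> heinz a H <= heinz b H.
Proof.
have -> : heinz b H = heinz `|b| H.
  by case: (ger0P b) => _; [ | rewrite heinzN].
move: `|b| => {}b; rewrite ler_norml => ab.
pose K := P *m H *m P^t*.
pose m (s : R) i j := expR (s * (x i - x j)) + expR (- (s * (x i - x j))).
(* [W] absorbs the factors [A^(1/2)] on both sides, leaving multipliers in [x i - x j] alone. *)
pose W := hadamard (fun i j => expR (2^-1 * (x i + x j))) K.
have hE s : heinz s H = N (hadamard (m s) W).
  pose f a b (i j : 'I_n) := expR (a * x i) * expR (b * x j).
  have -> : hadamard (m s) W =
      hadamard (f (2^-1 + s) (2^-1 - s)) K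
      + hadamard (f (2^-1 - s) (2^-1 + s)) K.
    rewrite -hadamardD hadamardM; apply: eq_hadamard => i j.
    by rewrite /m /f mulrDl -!expRD; congr (expR _ + expR _); ring.
  by rewrite -[RHS]norm_spectralD; congr (N (_ + _)); exact: mxpow_mul_mxpow.
have heven := heinzN H b.
rewrite !hE in heven *.
have := @norm_hadamard_max _ _ _ hN hU x x m W (- b) b a.
rewrite heven maxxx; apply=> //.
  move=> i j s; apply: cvgD; apply: continuous_comp; try exact: continuous_expR.
    by apply: cvgM; [exact: cvg_id | exact: cvg_cst].
  by apply: cvgN; apply: cvgM; [exact: cvg_id | exact: cvg_cst].
move=> s h i j; rewrite /m; set y := x i - x j.
rewrite [(s + h) * y]mulrDl [(s - h) * y]mulrBl opprB opprD !expRD; ring.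
Qed.

Lemma norm_le_num_radius X theta :
  N (mxRe (expi theta *: X)) <= num_radius N X.
Proof.
apply: ub_le_sup; last by exists theta.
exact: (num_radius_has_sup X hN).2.
Qed.

Lemma num_radius_le X (c : R) :
  (forall theta, N (mxRe (expi theta *: X)) <= c) -> num_radius N X <= c.
Proof.
move=> H; apply: ge_sup; first exact: (num_radius_has_sup X hN).1.
by move=> _ [theta _ <-].
Qed.

End UnitarilyInvariantNorm.

Theorem lemma2p1 (R : realType) (n : nat) (N : 'M[R[i]]_n -> R)
    (A X : 'M[R[i]]_n) (hN : matrix_norm N) (hU : unitarily_invariant N)
    (hA : posdefmx A) (t : R) (ht : 0 <= t <= 1) :
  num_radius N (mxpow A t *m X *m mxpow A t)
    <= num_radius N (A *m X *m A) `^ t * num_radius N X `^ (1 - t)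
  /\ 2 * num_radius N (mxpow A 2^-1 *m X *m mxpow A 2^-1)
      <= num_radius N (mxpow A t *m X *m mxpow A (1 - t)
                       + mxpow A (1 - t) *m X *m mxpow A t)
      <= num_radius N (A *m X + X *m A).
Proof.
have hP s := mxpow_herm hA s.
split.
  apply: num_radius_le => // theta; rewrite (mxRe_congruence (hP t)).
  apply: le_trans (norm_mxpow_log_convex hN hU hA _ ht) _.
  have /andP[t0 t1] := ht.
  have NX0 Y : 0 <= num_radius N Y.
    by apply: le_trans (norm_le_num_radius hN Y 0); exact: matrix_norm_ge0.
  apply: ler_pM; rewrite ?powR_ge0//.
    apply: ge0_ler_powR => //; rewrite ?nnegrE ?(matrix_norm_ge0 hN)//.
    have hA1 : A^t* = A by rewrite -(mxpow1 hA).
    by rewrite -(mxRe_congruence hA1); exact: norm_le_num_radius.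
  apply: ge0_ler_powR; rewrite ?nnegrE ?(matrix_norm_ge0 hN) ?subr_ge0//.
  exact: norm_le_num_radius.
pose S s := mxpow A s *m X *m mxpow A (1 - s)
  + mxpow A (1 - s) *m X *m mxpow A s.
(* The exponents [2^-1], [t] and [1] become the parameters [0], [t - 2^-1] and [2^-1], of increasing
   absolute value. *)
have heinzE (theta : R) s : N (mxRe (expi theta *: S s))
    = heinz N A (s - 2^-1) (mxRe (expi theta *: X)).
  rewrite /S (mxRe_sandwich (hP s) (hP (1 - s))) /heinz.
  have -> : 2^-1 + (s - 2^-1) = s by lra.
  by have -> : 2^-1 - (s - 2^-1) = 1 - s by lra.
have S12 : S 2^-1 = 2%:C *: (mxpow A 2^-1 *m X *m mxpow A 2^-1).
  rewrite /S (_ : 1 - 2^-1 = 2^-1 :> R); last by lra.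
  by rewrite rmorph_nat scaler_nat mulr2n.
have S1 : S 1 = A *m X + X *m A.
  by rewrite /S subrr (mxpow1 hA) (mxpow0 hA) mul1mx mulmx1.
rewrite -S1 -/(S t); clearbody S.
apply/andP; split; last first.
  apply: num_radius_le => // theta.
  apply: le_trans (norm_le_num_radius hN (S 1) theta).
  rewrite (heinzE theta t) (heinzE theta 1).
  apply: heinz_le => //; rewrite [leRHS]ger0_norm; last by lra.
  by rewrite ler_norml; lra.
(* The factor [2] is moved across to bound the supremum angle by angle, then restored. *)
rewrite -ler_pdivlMl//; apply: num_radius_le => // theta.
rewrite ler_pdivlMl//.
have -> : 2 * N (mxRe (expi theta *: (mxpow A 2^-1 *m X *m mxpow A 2^-1))) =
    N (mxRe (expi theta *: S 2^-1)).
  rewrite S12; move: (_ *m X *m _) (expi theta) => M z.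
  have -> : 2 * N (mxRe (z *: M)) = N (2%:C *: mxRe (z *: M)).
    by rewrite matrix_normZr// ger0_norm.
  apply: (congr1 N); apply/matrixP => i j; rewrite !mxE.
  by rewrite !(rmorphM, rmorph_nat); ring.
apply: le_trans (norm_le_num_radius hN (S t) theta).
rewrite (heinzE theta t) (heinzE theta 2^-1) (subrr (2^-1 : R)).
by apply: heinz_le => //; rewrite normr0.
Qed.
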